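(* Let $g$ be an element of $SL_n(q)$ which is real in $GL_n(q)$. Let $g$ be of type $\nu=1^{n_1}2^{n_2}\cdots$, with associated self-reciprocal polynomials $u_i\in\mathbb{F}_q[t]$ of degree $n_i$. Then: (1) if $n\not\equiv 2\pmod 4$ or if $q$ is even, then $g$ is real as well as strongly real in $SL_n(q)$; (2) if $n\equiv 2\pmod 4$ and $q$ is odd, then $g$ is strongly real in $SL_n(q)$ if and only if there is an odd $i$ for which $1$ or $-1$ is a root of $u_i(t)$.
   Context: An element $g$ of a group $G$ is real in $G$ if $hgh^{-1}=g^{-1}$ for some $h\in G$, and strongly real in $G$ if $h\in G$ can be chosen with $h^2=1$. For $g\in GL_n(q)$, view $\mathbb{F}_q^n$ as an $\mathbb{F}_q[t]$-module with $t$ acting as $g$, and decompose it as $\bigoplus_j \mathbb{F}_q[t]/(f_j(t)^{a_j})$ with $f_j$ monic irreducible, $f_j\ne t$ (elementary divisors, with multiplicity). For $i\ge1$ let $u_i(t)$ be the scalar multiple, with constant term $1$, of $\prod_{j:\,a_j=i}f_j(t)$. Put $n_i=\deg u_i$; then $\sum_i i n_i=n$, and $g$ is said to be of type $\nu$, where $\nu=1^{n_1}2^{n_2}\cdots$ is the partition of $n$ with $n_i$ parts equal to $i$. A polynomial is self-reciprocal if its list of roots (with multiplicity, in the algebraic closure) is equal to the list of inverses of its roots; for $g$ real in $GL_n(q)$ all the $u_i$ are self-reciprocal. *)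

(* Defs.v *)
From mathcomp Require Import all_boot all_order all_fingroup all_algebra.

Set Implicit Arguments.
Unset Strict Implicit.
Unset Printing Implicit Defensive.

Import GRing.Theory.
Local Open Scope ring_scope.

Section Reality.

Local Open Scope group_scope.

Definition real_in (gT : finGroupType) (G : {group gT}) (g : gT) : Prop :=
  exists2 h : gT, h \in G & h * g * h^-1 = g^-1.

Definition strongly_real_in (gT : finGroupType) (G : {group gT}) (g : gT) :
    Prop :=
  exists h : gT, [/\ h \in G, h ^+ 2 = 1 & h * g * h^-1 = g^-1].

End Reality.

Section SpecialLinearGroup.

Variables (n : nat) (F : finFieldType).

Definition SLset : {set {'GL_n[F]}} := [set g | \det (GLval g) == 1].

Lemma SLset_group_set : group_set SLset.
Proof.
apply/group_setP; split=> [|g h]; rewrite !inE ?GL_1E ?det1 //.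
by rewrite GL_ME detM => /eqP-> /eqP->; rewrite mulr1.
Qed.

Definition SL : {group {'GL_n[F]}} := Group SLset_group_set.

End SpecialLinearGroup.

Section ElementaryDivisors.

Variables (F : fieldType).

(* A pair (f, a) in s stands for the elementary divisor f ^+ a. *)
Implicit Types s : seq ({poly F} * nat).

Definition eldiv s (j : 'I_(size s)) : {poly F} :=
  let: (f, a) := tnth (in_tuple s) j in f ^+ a.

(* The direct sum of the cyclic modules F[t]/(f_j ^ a_j). *)
Definition cyclic_sum s : Type :=
  {dffun forall j : 'I_(size s), {poly %/ eldiv j}}.

(* phi is an isomorphism of F[t]-modules from cyclic_sum s to the space of   *)
(* column vectors, on which t acts as v |-> g *m v. The library's {poly %/ p} *)
(* is the quotient by p only for p monic and nonconstant (otherwise it is     *)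
(* the quotient by 'X); the conditions in elementary_divisors ensure this.    *)
Definition module_iso (n : nat) (g : 'M[F]_n.+1) s
    (phi : cyclic_sum s -> 'cV[F]_n.+1) : Prop :=
  [/\ forall x y : cyclic_sum s,
        phi [ffun j => x j + y j] = phi x + phi y,
      forall (p : {poly F}) (x : cyclic_sum s),
        phi [ffun j => in_qpoly (eldiv j) p * x j] = horner_mx g p *m phi x
    & bijective phi].

(* The list s is unique up to reordering. *)
Definition elementary_divisors (n : nat) (g : 'M[F]_n.+1) s : Prop :=
  (forall fa, fa \in s ->
     [/\ fa.1 \is monic, irreducible_poly fa.1, fa.1 != 'X & (0 < fa.2)%N])
  /\ exists phi : cyclic_sum s -> 'cV[F]_n.+1, module_iso g phi.

(* u_i: the product of the f_j with a_j = i, scaled to have constant term 1. *)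
Definition type_poly s (i : nat) : {poly F} :=
  let p := \prod_(fa <- s | fa.2 == i) fa.1 in (p`_0)^-1 *: p.

End ElementaryDivisors.

(* Main.v *)
Require Import Defs.
From HB Require Import structures.
From mathcomp Require Import all_boot all_order all_fingroup all_algebra.
From mathcomp Require Import all_field ring zify.

Set Implicit Arguments.
Unset Strict Implicit.
Unset Printing Implicit Defensive.

Import GRing.Theory.
Local Open Scope ring_scope.

(** Transposing turns the column action of g into the row action of A = g^T;
    an involution h with det h = 1 and h A h = A^-1 is what strong reality
    asks for.

    Existence of an involution reversing A.  Reality of g gives
    rank p(A) = rank p(A^-1) for every polynomial p ([rank_real]), and this
    condition, unlike similarity of A and A^-1, passes at once to the
    complement of an invariant direct summand that satisfies it.  The space is
    therefore decomposed by induction ([reversal_dichotomyP]): a suitable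
    cyclic subspace F[A]v is split off ([cyclic_split]), and on a cyclic space
    of dimension k on which A and A^-1 satisfy the same polynomial the map
    v A^i |-> v A^(k-1-i) is a reversing involution ([cyclic_reversible]).

    Controlling the sign.  A summand of odd dimension lets one replace h by -h
    there, so that both determinants are reached ([flexible]).  The pieces are
    chosen as the (t-1)- or (t+1)-primary ones while 1 or -1 is an eigenvalue
    and arbitrary afterwards ([cyclic_piece]); so if all the pieces have even
    dimension then, in odd characteristic, the eigenvalues 1 and -1 have no
    Jordan block of odd size ([no_odd_block] for A^2 - 1).

    The even case.  If h reverses A, then h anticommutes with N = A - A^-1, so
    N maps each of the two eigenspaces of h into the other.  Where N is
    invertible they have equal dimension, and along the chain of a Jordan block
    of N at 0 the sign of h alternates, so that a block of even size
    contributes equally to both.  Hence without blocks of odd size the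
    eigenspaces have dimension n/2, and h has determinant (-1)^(n/2)
    ([reversal_det]).  This is 1 if 4 divides n and -1 if n = 2 mod 4, which
    settles both parts of the theorem once the block condition is read off the
    elementary divisors ([no_odd_block_elementary_divisors]); for n odd there
    is always a summand of odd dimension, and in characteristic 2 every
    involution has determinant 1. *)

(** * Evaluating polynomials at square matrices *)

Section PolynomialsOfMatrices.

Variable F : fieldType.
Implicit Types (p q : {poly F}).

(** The value p(A) for every size n, 0 included, so that inductions on the
    dimension can end at the zero space; see [mxevalE] for positive sizes. *)
Definition mxeval n (A : 'M[F]_n) p : 'M[F]_n := \sum_(i < size p) p`_i *: A ^+ i.

Lemma mxevalE n (A : 'M[F]_n.+1) p : mxeval A p = horner_mx A p.
Proof.
rewrite /horner_mx /horner_morph horner_coef size_map_poly; apply: eq_bigr => i _.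
by rewrite coef_map -mul_scalar_mx.
Qed.

Lemma mxeval_zmod n (A : 'M[F]_n) : zmod_morphism (mxeval A).
Proof.
by case: n A => [|n] A p q; rewrite ?thinmx0 // !mxevalE rmorphB.
Qed.

Lemma mxeval_monoid n (A : 'M[F]_n) : monoid_morphism (mxeval A).
Proof.
case: n A => [|n] A; first by split=> [|p q]; rewrite thinmx0 // [RHS]thinmx0.
by split=> [|p q]; rewrite !mxevalE ?rmorph1 ?rmorphM.
Qed.

HB.instance Definition _ n A := GRing.isZmodMorphism.Build {poly F} 'M[F]_n
  (mxeval A) (mxeval_zmod A).
HB.instance Definition _ n A := GRing.isMonoidMorphism.Build {poly F} 'M[F]_n
  (mxeval A) (mxeval_monoid A).

Lemma mxevalX n (A : 'M[F]_n) : mxeval A 'X = A.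
Proof. by case: n A => [|n] A; rewrite ?mxevalE ?horner_mx_X // [LHS]thinmx0 [RHS]thinmx0. Qed.

Lemma mxevalC n (A : 'M[F]_n) c : mxeval A c%:P = c%:M.
Proof. by case: n A => [|n] A; rewrite ?mxevalE ?horner_mx_C // [LHS]thinmx0 [RHS]thinmx0. Qed.

Lemma mxevalM n (A : 'M[F]_n) p q : mxeval A (p * q) = mxeval A p *m mxeval A q.
Proof. exact: rmorphM. Qed.

Lemma mxeval_tr n (A : 'M[F]_n) p : mxeval A^T p = (mxeval A p)^T.
Proof.
rewrite /mxeval raddf_sum; apply: eq_bigr => i _ /=; rewrite linearZ /=.
congr (_ *: _); elim: (val i) => [|j IHj]; first by rewrite !expr0 trmx1.
by rewrite exprS exprSr IHj trmx_mul.
Qed.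

Lemma mxeval_intertwine k n (K : 'M[F]_(k, n)) (A : 'M_n) (C : 'M_k) p :
  K *m A = C *m K -> K *m mxeval A p = mxeval C p *m K.
Proof.
move=> KA; rewrite /mxeval mulmx_sumr mulmx_suml; apply: eq_bigr => i _.
rewrite -scalemxAl -scalemxAr; congr (_ *: _).
elim: (val i) => [|j IHj]; first by rewrite !expr0 mulmx1 mul1mx.
by rewrite exprSr [in RHS]exprSr mulmxA IHj -mulmxA KA mulmxA.
Qed.

Lemma mxevalXn n (A : 'M[F]_n) i : mxeval A 'X^i = A ^+ i.
Proof. by rewrite rmorphXn /= mxevalX. Qed.

Lemma mxevalZ n (A : 'M[F]_n) c p : mxeval A (c *: p) = c *: mxeval A p.
Proof. by rewrite -mul_polyC mxevalM mxevalC mul_scalar_mx. Qed.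

Lemma mxeval_mod n (A : 'M[F]_n) (v : 'rV_n) p q : v *m mxeval A p = 0 ->
  v *m mxeval A (q %% p) = v *m mxeval A q.
Proof.
move=> vp; rewrite [in RHS](divp_eq q p) rmorphD /= mulmxDr mulrC mxevalM.
by rewrite mulmxA vp mul0mx add0r.
Qed.

Lemma intertwine_expr k n (K : 'M_(k, n)) (A : 'M[F]_n) (C : 'M_k) i :
  K *m A = C *m K -> K *m A ^+ i = C ^+ i *m K.
Proof. by move=> KA; rewrite -!mxevalXn (mxeval_intertwine _ KA). Qed.

Lemma mxeval_block k l (C : 'M[F]_k) (B : 'M[F]_l) p :
  mxeval (block_mx C 0 0 B) p = block_mx (mxeval C p) 0 0 (mxeval B p).
Proof.
elim/poly_ind: p => [|p c IHp]; first by rewrite !raddf0 block_mx0.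
rewrite !rmorphD /= !mxevalM !mxevalC !mxevalX IHp mulmx_block scalar_mx_block.
by rewrite add_block_mx !(mulmx0, mul0mx, addr0, add0r).
Qed.

Lemma inverse_expr n (C D : 'M[F]_n) i j : D *m C = 1%:M -> (i <= j)%N ->
  D ^+ i *m C ^+ j = C ^+ (j - i).
Proof.
move=> DC; elim: i j => [|i IHi] [|j] // le_ij; rewrite ?expr0 ?mul1mx ?subn0 //.
by rewrite exprSr exprS -[LHS]mulmxA (mulmxA D) DC mul1mx IHi.
Qed.

End PolynomialsOfMatrices.

(** * Annihilators and cyclic vectors *)

Section Annihilators.

Variable F : fieldType.
Implicit Types (p q d e f r : {poly F}).

Definition ann n (A : 'M[F]_n) (v : 'rV_n) d :=
  forall p, (v *m mxeval A p == 0) = (d %| p).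

Lemma ann_mul n (A : 'M[F]_n) v d e :
  e != 0 -> ann A v (d * e) -> ann A (v *m mxeval A e) d.
Proof.
by move=> e0 Hv p; rewrite -mulmxA -mxevalM Hv mulrC dvdp_mul2l.
Qed.

Lemma irredp_coprime f q : irreducible_poly f -> ~~ (f %| q) -> coprimep f q.
Proof.
move=> irr_f fq; have [//|ncop] := boolP (coprimep f q).
have /irr_f := dvdp_gcdl f q.
rewrite -/(coprimep f q) => /(_ ncop) /eqp_dvdl E.
by rewrite -E dvdp_gcdr in fq.
Qed.

Lemma irredp_factor_power f q : irreducible_poly f -> q != 0 ->
  exists a r, q = f ^+ a * r /\ ~~ (f %| r).
Proof.
move=> irr_f; have f0 := irredp_neq0 irr_f.
have [m le_m] := ubnP (size q); elim: m q le_m => // m IHm q lt_q q0.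
have [/dvdpP[r Dq] | fq] := boolP (f %| q); last by exists 0, q; rewrite mul1r.
have r0 : r != 0 by apply: contraNneq q0 => r0; rewrite Dq r0 mul0r.
have /IHm/(_ r0)[a [s [Dr fs]]] : (size r < m)%N.
  rewrite -ltnS; apply: leq_trans lt_q; rewrite Dq size_mul //.
  by have [f1 _] := irr_f; case: (size f) f1 => [|[|k]] // _; rewrite !addnS ltnS leq_addr.
by exists a.+1, s; rewrite Dq Dr mulrC exprS mulrA.
Qed.

(** Bezout: if f^a.+1 did not divide a polynomial p killing v, the gcd of the
    two would divide f^a, and v would already be killed by f^a. *)
Lemma ann_prime_power n (A : 'M[F]_n) v f a : irreducible_poly f ->
    v *m mxeval A (f ^+ a) != 0 -> v *m mxeval A (f ^+ a.+1) = 0 ->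
  ann A v (f ^+ a.+1).
Proof.
move=> irr_f nz_v v0 p; apply/eqP/idP=> [vp | /dvdpP[q ->]]; last first.
  by rewrite mulrC mxevalM mulmxA v0 mul0mx.
have [->|p0] := eqVneq p 0; first by rewrite dvdp0.
have [j [s [Dp fs]]] := irredp_factor_power irr_f p0.
have [le_aj|lt_ja] := ltnP a j; first by rewrite Dp dvdp_mulr // dvdp_exp2l.
case/eqP: nz_v.
have /Bezout_eq1_coprimepP[[u w] /= uw] := irredp_coprime irr_f fs.
have -> : f ^+ a = f ^+ a.+1 * u + p * (f ^+ (a - j) * w).
  rewrite -[LHS]mulr1 -uw mulrDr exprSr -!mulrA (mulrC u) Dp; congr (_ + _).
  by rewrite -{1}(subnK lt_ja) exprD -!mulrA (mulrC w) mulrCA; congr (_ * _); rewrite mulrCA.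
by rewrite rmorphD /= !mxevalM mulmxDr !mulmxA v0 vp !mul0mx addr0.
Qed.

Lemma ann_coprime_add n (A : 'M[F]_n) v w d e : coprimep d e ->
  ann A v d -> ann A w e -> ann A (v + w) (d * e).
Proof.
move=> cop_de Hv Hw p; rewrite Gauss_dvdp //; apply/eqP/andP=> [|[dp ep]]; last first.
  move: dp ep; rewrite -Hv -Hw mulmxDl => /eqP-> /eqP->.
  by rewrite addr0.
rewrite mulmxDl => /eqP; rewrite addr_eq0 => /eqP vw.
split.
  rewrite -(Gauss_dvdpr _ cop_de) -Hv mulrC mxevalM mulmxA vw mulNmx oppr_eq0.
  by rewrite -mulmxA -mxevalM Hw dvdp_mull.
move: cop_de; rewrite coprimep_sym => cop_ed.
rewrite -(Gauss_dvdpr _ cop_ed) -Hw mulrC mxevalM mulmxA.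
by rewrite -[w *m _]opprK -vw mulNmx oppr_eq0 -mulmxA -mxevalM Hv dvdp_mull.
Qed.

End Annihilators.

Section CyclicVector.

Variable F : finFieldType.
Implicit Types (p q d e f r : {poly F}).

Lemma irredp_factor q : (1 < size q)%N -> exists2 f, irreducible_poly f & f %| q.
Proof.
have [m le_m] := ubnP (size q); elim: m q le_m => // m IHm q lt_q q1.
have [/irreducibleP irr_q|] := boolP (irreducibleb q); first by exists q.
rewrite /irreducibleb q1 /= => /forallPn[/= r].
rewrite negb_imply -ltnNge -Pdiv.Idomain.dvdpE => /andP[rq r1].
have [|f irr_f fr] := IHm r _ r1; last by exists f => //; apply: dvdp_trans rq.
apply: leq_ltn_trans (size_npoly r) _.
by rewrite -ltnS; apply: leq_trans lt_q; rewrite !prednK // ltnW.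
Qed.

(** Induction on the divisors d of the minimal polynomial: the part of d at an
    irreducible factor f, say f^a, generates the annihilator of v e(A), where
    e is the minimal polynomial divided by f^a and v is a row that the minimal
    polynomial divided by f does not kill.  Adding a vector for the part of d
    prime to f multiplies the annihilators. *)
Lemma cyclic_vector n (A : 'M[F]_n.+1) : exists v, ann A v (mxminpoly A).
Proof.
set m := mxminpoly A; have m0 : m != 0 by rewrite monic_neq0 ?mxminpoly_monic.
suff: forall d, d %| m -> exists v, ann A v d by apply; apply: dvdpp.
move=> d; have [k le_k] := ubnP (size d); elim: k d le_k => // k IHk d lt_d dm.
have [d1|d1] := leqP (size d) 1.
  exists 0 => p; rewrite mul0mx eqxx; apply/esym.
  have: d %= 1.
    rewrite -size_poly_eq1 eqn_leq d1 size_poly_gt0.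
    by apply: contraNneq m0 => d0; rewrite d0 dvd0p in dm.
  by move/eqp_dvdl->; rewrite dvd1p.
have [f irr_f fd] := irredp_factor d1.
have d0 : d != 0 by rewrite -size_poly_gt0 ltnW.
have [a [r [Dd fr]]] := irredp_factor_power irr_f d0.
case: a => [|a] in Dd; first by rewrite Dd mul1r (negPf fr) in fd.
have f0 := irredp_neq0 irr_f; have [f1 _] := irr_f.
have r0 : r != 0 by apply: contraNneq d0 => r0; rewrite Dd r0 mulr0.
have [||w Hw] := IHk r.
- rewrite -ltnS; apply: leq_trans lt_d; rewrite ltnS Dd size_mul ?expf_neq0 //.
  have: (1 < size (f ^+ a.+1))%N by rewrite -subn_gt0 subn1 size_exp muln_gt0 -subn1 subn_gt0 f1.
  by case: (size _) => [|[|c]] // _; rewrite !addSn /= ltnS leq_addl.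
- by apply: dvdp_trans dm; rewrite Dd dvdp_mull.
have /dvdpP[e De] : f ^+ a.+1 %| m by apply: dvdp_trans dm; rewrite Dd dvdp_mulr.
(* e * f ^+ a is a proper divisor of the minimal polynomial. *)
have [v nzv] : exists v : 'rV_n.+1, v *m mxeval A (e * f ^+ a) != 0.
  have: mxeval A (e * f ^+ a) != 0.
    rewrite mxevalE -dvd_mxminpoly -/m De exprS mulrCA -{2}[e * _]mul1r.
    rewrite dvdp_mul2r ?dvdp1; first by rewrite gtn_eqF.
    by rewrite mulf_neq0 ?expf_neq0 //; apply: contraNneq m0 => e0; rewrite De e0 mul0r.
  rewrite -nz_row_eq0; have /submxP[v ->] := nz_row_sub (mxeval A (e * f ^+ a)).
  by exists v.
exists (v *m mxeval A e + w); rewrite Dd; apply: ann_coprime_add => //.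
  by rewrite coprimep_expl // irredp_coprime.
apply: ann_prime_power => //; rewrite -mulmxA -mxevalM // -De mxevalE.
by rewrite mx_root_minpoly mulmx0.
Qed.

End CyclicVector.

(** * Splitting off a cyclic summand *)

Section CyclicSplitting.

Variable F : fieldType.
Implicit Types (p q r : {poly F}).

Definition krylov k n (A : 'M[F]_n) (v : 'rV_n) : 'M_(k, n) :=
  \matrix_(i < k) (v *m A ^+ i).

Lemma mul_krylov k n (A : 'M[F]_n) (v : 'rV_n) (u : 'rV_k) :
  u *m krylov k A v = v *m mxeval A (rVpoly u).
Proof.
rewrite [u]row_sum_delta mulmx_suml (linear_sum rVpoly) (raddf_sum (mxeval A)) mulmx_sumr.
apply: eq_bigr => i _; rewrite linearZ /= rVpoly_delta mxevalZ mxevalXn.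
by rewrite -scalemxAl -scalemxAr -rowE rowK.
Qed.

Lemma krylov_mod k n (A : 'M[F]_n) (v : 'rV_n) p q :
    size p = k.+1 -> v *m mxeval A p = 0 ->
  poly_rV (q %% p) *m krylov k A v = v *m mxeval A q.
Proof.
move=> size_p vp; rewrite mul_krylov poly_rV_K ?mxeval_mod //.
by rewrite -ltnS -size_p ltn_modp -size_poly_gt0 size_p.
Qed.

Lemma krylov_stable k n (A : 'M[F]_n) (v : 'rV_n) p :
    size p = k.+1 -> v *m mxeval A p = 0 ->
  exists C : 'M_k, krylov k A v *m A = C *m krylov k A v.
Proof.
move=> size_p vp; exists (\matrix_(i < k) poly_rV ('X^(i.+1) %% p)).
apply/row_matrixP => i; rewrite !row_mul !rowK krylov_mod // mxevalXn.
by rewrite -mulmxA exprSr.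
Qed.

Lemma krylov_free k n (A : 'M[F]_n) (v : 'rV_n) p :
  size p = k.+1 -> ann A v p -> row_free (krylov k A v).
Proof.
move=> size_p Hv; apply: inj_row_free => u /eqP; rewrite mul_krylov Hv.
move=> /dvdp_leq; have [u0 _|_ /(_ isT)] := eqVneq (rVpoly u) 0.
  by rewrite -[u]rVpolyK u0 linear0.
by rewrite size_p ltnNge size_poly.
Qed.

(** An invariant complement to F[A]v is the common kernel of the functionals
    x |-> x A^j phi, where phi pairs v A^i with 0 for i < k-1 and with 1 for
    i = k-1: the pairing matrix (v A^(i+j) phi) is then triangular with unit
    antidiagonal, hence invertible.  For this kernel to be invariant phi must
    also satisfy p(A) phi = 0; multiplying by the idempotent polynomial w r,
    which is 1 modulo p and 0 modulo r, achieves that without changing the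
    pairing with F[A]v, as p kills v. *)
Lemma cyclic_split k n (A : 'M[F]_n) (v : 'rV_n) p r : size p = k.+1 -> coprimep p r ->
    mxeval A (p * r) = 0 -> ann A v p ->
  exists l (C : 'M_k) (B : 'M_l) (K : 'M_(k, n)) (M : 'M_(l, n)),
    [/\ n = (k + l)%N, row_free (col_mx K M), K *m A = C *m K,
        M *m A = B *m M & exists e, ann C e p /\ e *m K = v].
Proof.
move=> size_p cop_pr kill_pr Hv.
have p0 : p != 0 by rewrite -size_poly_gt0 size_p.
have vp : v *m mxeval A p = 0 by apply/eqP; rewrite Hv.
set K := krylov k A v; have freeK : row_free K := krylov_free size_p Hv.
have [C KA] := krylov_stable size_p vp.
have [phi Hphi pphi] : exists2 phi : 'cV[F]_n,
    forall q, (size q <= k)%N -> v *m mxeval A q *m phi = (q`_k.-1)%:M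
  & mxeval A p *m phi = 0.
  have /Bezout_eq1_coprimepP[[u w] /= uw] := cop_pr.
  pose phi0 := pinvmx K *m (\col_i (i == k.-1 :> nat)%:R).
  exists (mxeval A (w * r) *m phi0); last first.
    by rewrite mulmxA -mxevalM mulrCA mulrC mxevalM kill_pr !mul0mx.
  move=> q size_q; rewrite mulmxA.
  have -> : v *m mxeval A q *m mxeval A (w * r) = poly_rV q *m K.
    rewrite mul_krylov poly_rV_K // -mulmxA -mxevalM -[in LHS](addKr (u * p) (w * r)) uw.
    rewrite mulrDr mulr1 rmorphD /= addrC mulmxDr mulrN mulrA rmorphN /= mulrC.
    by rewrite mxevalM mulmxN mulmxA vp mul0mx oppr0 addr0.
  rewrite mulmxA -(mulmxA _ K) mulmxVp // mulmx1 [LHS]mx11_scalar.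
  congr (_%:M); rewrite mxE; case: k q size_q {size_p K freeK C KA phi0} => [|k] q size_q.
    by rewrite big_ord0 nth_default.
  rewrite (bigD1 ord_max) //= !mxE eqxx mulr1 big1 ?addr0 // => i.
  by rewrite -val_eqE !mxE /= => /negPf->; rewrite mulr0.
pose L := (krylov k A^T phi^T)^T.
have [D AL] : exists D, A *m L = L *m D.
  have [|D AD] := krylov_stable (A := A^T) (v := phi^T) size_p _.
    by rewrite mxeval_tr -trmx_mul pphi trmx0.
  by exists D^T; apply: trmx_inj; rewrite !trmx_mul !trmxK.
(* If v q(A) is in the kernel with d = deg q < k, pairing with A^(k-1-d) phi
   extracts the leading coefficient of q. *)
have KLinj (u : 'rV_k) : u *m K *m L = 0 -> u = 0.
  move=> uKL; apply: (can_inj rVpolyK); rewrite linear0; apply/eqP.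
  set q := rVpoly u; apply/negPn/negP => q0.
  have size_q : (size q <= k)%N := size_poly _ _.
  have q1 : (0 < size q)%N by rewrite size_poly_gt0.
  have lt_jk : (k - size q < k)%N by rewrite ltn_subrL q1 (leq_trans q1).
  have size_qX : (size (q * 'X^(k - size q))%R <= k)%N.
    by rewrite size_Mmonic ?monicXn // size_polyXn addnS /= subnKC.
  have := Hphi _ size_qX.
  have colL : col (Ordinal lt_jk) L = mxeval A 'X^(k - size q) *m phi.
    by rewrite -tr_row rowK mxevalXn trmx_mul trmxK -mxevalXn mxeval_tr trmxK mxevalXn.
  rewrite mxevalM mulmxA -mulmxA -colL -mul_krylov colE mulmxA uKL mul0mx.
  move/matrixP/(_ 0 0); rewrite !mxE eqxx mulr1n coefMXn.
  rewrite ltnNge -subn1 leq_sub2l //= => /esym/eqP.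
  by rewrite subnAC subKn // subn1 -/(lead_coef q) lead_coef_eq0 (negPf q0).
have rankL : \rank L = k.
  apply/eqP; rewrite eqn_leq rank_leq_col /=.
  have /eqP rKL : row_free (K *m L) by apply: inj_row_free => u; rewrite mulmxA => /KLinj.
  by apply: leq_trans (mxrankM_maxr K L); rewrite rKL.
set Z := kermx L.
have rankZ : \rank Z = (n - k)%N by rewrite mxrank_ker rankL.
have ZA : (Z *m A <= Z)%MS.
  by apply/sub_kermxP; rewrite -mulmxA AL mulmxA mulmx_ker mul0mx.
have /submxP[B MA] : (row_base Z *m A <= row_base Z)%MS.
  by rewrite eq_row_base (submx_trans _ ZA) // submxMr // eq_row_base.
have dimn : n = (k + \rank Z)%N.
  by rewrite rankZ subnKC // -rankL rank_leq_row.
exists (\rank Z), C, B, K, (row_base Z); split=> //.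
  rewrite /row_free -addsmxE mxrank_disjoint_sum.
    by rewrite (eqP freeK) eq_row_base.
  apply/eqP; rewrite -submx0; apply/rV_subP => x.
  rewrite sub_capmx eq_row_base => /andP[/submxP[u ->] /sub_kermxP /KLinj->].
  by rewrite mul0mx sub0mx.
have eK : poly_rV (1 %% p) *m K = v by rewrite krylov_mod // rmorph1 mulmx1.
exists (poly_rV (1 %% p)); split=> // q.
rewrite -Hv -[in RHS]eK -mulmxA (mxeval_intertwine _ KA) mulmxA.
apply/eqP/eqP => [->|]; first by rewrite mul0mx.
by move=> eqK; apply: (row_free_inj freeK); rewrite eqK mul0mx.
Qed.

End CyclicSplitting.

(** * Involutions reversing a matrix *)

Section Reversal.

Variable F : fieldType.
Implicit Types (p q r : {poly F}).

(** For invertible A the second equation says h A h^-1 = A^-1. *)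
Definition reverses n (A h : 'M[F]_n) := h *m h = 1%:M /\ A *m h *m A = h.

(** Both signs occur as determinants of reversing involutions. *)
Definition flexible n (A : 'M[F]_n) :=
  forall b : bool, exists h, reverses A h /\ \det h = (-1) ^+ b.

Lemma involution_det n (h : 'M[F]_n) : h *m h = 1%:M ->
  exists b : bool, \det h = (-1) ^+ b.
Proof.
move/(congr1 determinant); rewrite det_mulmx det1 -expr2 => /eqP.
by rewrite sqrf_eq1 => /orP[]/eqP->; [exists false | exists true].
Qed.

Lemma flexible_odd n (A h : 'M[F]_n) : odd n -> reverses A h -> flexible A.
Proof.
move=> odd_n [hh AhA] b; have [c det_h] := involution_det hh.
have [->|neq_bc] := eqVneq b c; first by exists h.
exists (- h); split; first by split; rewrite !(mulmxN, mulNmx) ?opprK ?AhA.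
rewrite -scaleN1r detZ det_h -[(-1) ^+ n]signr_odd odd_n -signr_addb.
by case: b c neq_bc {det_h} => [] [].
Qed.

Lemma reverses_uconj n (A B T h : 'M[F]_n) : T \in unitmx ->
  T *m A = B *m T -> reverses B h -> reverses A (invmx T *m h *m T).
Proof.
move=> Tu TA [hh BhB]; split.
  by rewrite !mulmxA mulmxK // -(mulmxA _ h h) hh mulmx1 mulVmx.
have AT : A *m invmx T = invmx T *m B.
  by rewrite -[LHS](mulKmx Tu) (mulmxA T) TA mulmxK.
rewrite !mulmxA AT -(mulmxA _ T A) TA !mulmxA.
by rewrite -(mulmxA _ B h) -(mulmxA _ (B *m h) B) BhB.
Qed.

Lemma det_uconj n (T h : 'M[F]_n) :
  T \in unitmx -> \det (invmx T *m h *m T) = \det h.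
Proof.
by move=> Tu; rewrite !det_mulmx mulrAC -det_mulmx mulVmx // det1 mul1r.
Qed.

Lemma det_invariant_split n k l (h : 'M[F]_n) (K : 'M_(k, n)) (L : 'M_(l, n)) C B :
    n = (k + l)%N -> row_free (col_mx K L) ->
    K *m h = C *m K -> L *m h = B *m L ->
  \det h = \det C * \det B.
Proof.
move=> n_kl; subst n; rewrite row_free_unit => Tu Kh Lh; set T := col_mx K L in Tu.
have Th : T *m h = block_mx C 0 0 B *m T.
  by rewrite mul_col_mx mul_block_col !mul0mx addr0 add0r Kh Lh.
have -> : h = invmx T *m block_mx C 0 0 B *m T by rewrite -mulmxA -Th mulKmx.
by rewrite det_uconj // det_lblock.
Qed.

Lemma flexible_uconj n (A B T : 'M[F]_n) : T \in unitmx ->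
  T *m A = B *m T -> flexible B -> flexible A.
Proof.
move=> Tu TA flexB b; have [h [rev_h det_h]] := flexB b.
exists (invmx T *m h *m T); rewrite det_uconj //; split=> //.
exact: reverses_uconj TA rev_h.
Qed.

Lemma reverses_diag k l (C hC : 'M[F]_k) (B hB : 'M[F]_l) :
    reverses C hC -> reverses B hB ->
  reverses (block_mx C 0 0 B) (block_mx hC 0 0 hB).
Proof.
move=> [hhC ChC] [hhB BhB]; split; rewrite !mulmx_block.
  by rewrite !mulmx0 !mul0mx !addr0 !add0r hhC hhB -scalar_mx_block.
by rewrite !(mulmx0, mul0mx, addr0, add0r) ChC BhB.
Qed.

Lemma flexible_diagl k l (C : 'M[F]_k) (B hB : 'M[F]_l) :
  flexible C -> reverses B hB -> flexible (block_mx C 0 0 B).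
Proof.
move=> flexC rev_hB b; have [c det_hB] := involution_det rev_hB.1.
have [hC [rev_hC det_hC]] := flexC (b (+) c).
exists (block_mx hC 0 0 hB); split; first exact: reverses_diag.
by rewrite det_lblock det_hC det_hB -signr_addb -addbA addbb addbF.
Qed.

Lemma flexible_diagr k l (C hC : 'M[F]_k) (B : 'M[F]_l) :
  reverses C hC -> flexible B -> flexible (block_mx C 0 0 B).
Proof.
move=> rev_hC flexB b; have [c det_hC] := involution_det rev_hC.1.
have [hB [rev_hB det_hB]] := flexB (c (+) b).
exists (block_mx hC 0 0 hB); split; first exact: reverses_diag.
by rewrite det_lblock det_hC det_hB -signr_addb addbA addbb addFb.
Qed.

Lemma reverses_inv n (A h : 'M[F]_n) : A \in unitmx -> reverses A h ->
  h *m A = invmx A *m h.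
Proof. by move=> Au [_ AhA]; rewrite -{2}AhA -mulmxA mulKmx. Qed.

(** The involution is e q(C) |-> e q(D) C^(k-1), well defined because p(C)
    and p(D) both kill e; on the basis e C^i it is the flip i |-> k-1-i. *)
Lemma cyclic_reversible k (C D : 'M[F]_k) e p : size p = k.+1 -> ann C e p ->
    C *m D = 1%:M -> e *m mxeval D p = 0 -> exists h, reverses C h.
Proof.
move=> size_p He CD ep; set K := krylov k C e.
have Ku : K \in unitmx by rewrite -row_free_unit (krylov_free size_p He).
have DC := mulmx1C CD.
have ep' : e *m mxeval C p = 0 by apply/eqP; rewrite He.
pose h := invmx K *m krylov k D e *m C ^+ k.-1.
have hE q : e *m mxeval C q *m h = e *m mxeval D q *m C ^+ k.-1.
  by rewrite -(krylov_mod q size_p ep') -(krylov_mod q size_p ep) !mulmxA mulmxK.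
have hXn i : e *m C ^+ i *m h = e *m D ^+ i *m C ^+ k.-1.
  by have := hE 'X^i; rewrite !mxevalXn.
clearbody h; exists h; split; apply: (can_inj (mulKmx Ku)); apply/row_matrixP => i.
  have le_ik : (i <= k.-1)%N by rewrite -ltnS prednK // (leq_ltn_trans _ (ltn_ord i)).
  rewrite mulmxA !row_mul !rowK hXn -(mulmxA e) inverse_expr // hXn.
  by rewrite -mulmxA inverse_expr ?leq_subr // subKn // mulmx1.
rewrite !mulmxA !row_mul !rowK -(mulmxA e _ C) -[C ^+ i *m C]exprSr !hXn.
have k_gt0 : (0 < k)%N by apply: leq_ltn_trans (ltn_ord i).
rewrite exprSr -!mulmxA; congr (_ *m (_ *m _)).
by rewrite -[C ^+ k.-1 *m C]exprSr exprS mulmxA DC mul1mx.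
Qed.

End Reversal.

(** * Absence of nilpotent Jordan blocks of odd size *)

Section NoOddBlock.

Variable F : fieldType.
Implicit Types (p q r f g : {poly F}).

(** The quotient of ker M^k by ker M^(k-1) + (ker M^(k+1)) M has as dimension
    the number of Jordan blocks of size k of M at the eigenvalue 0; this says
    that it vanishes for odd k, in a form that can be tested one direct summand
    at a time. *)
Definition no_odd_block n (M : 'M[F]_n) :=
  forall k, odd k -> forall x : 'rV_n, x *m M ^+ k = 0 ->
  exists y, x *m M ^+ k.-1 = y *m M ^+ k.

Lemma no_odd_block_uconj n (M N T : 'M[F]_n) : T \in unitmx ->
  T *m M = N *m T -> no_odd_block N -> no_odd_block M.
Proof.
move=> Tu TM nobN k odd_k x xM.
have TMk j : invmx T *m N ^+ j = M ^+ j *m invmx T.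
  by rewrite -[LHS](mulmxK Tu) -(mulmxA _ _ T) -(intertwine_expr _ TM) mulKmx.
have [|y Hy] := nobN k odd_k (x *m invmx T).
  by rewrite -mulmxA TMk mulmxA xM mul0mx.
exists (y *m T); rewrite -mulmxA (intertwine_expr _ TM) mulmxA -Hy -(mulmxA x) TMk.
by rewrite mulmxA mulmxKV.
Qed.

Lemma no_odd_block_diag k l (C : 'M[F]_k) (B : 'M[F]_l) :
  no_odd_block C -> no_odd_block B -> no_odd_block (block_mx C 0 0 B).
Proof.
move=> nobC nobB j odd_j x; rewrite -[x]hsubmxK -!mxevalXn !mxeval_block !mul_row_block.
rewrite !(mulmx0, addr0, add0r) -row_mx0 => /eq_row_mx[].
rewrite !mxevalXn => /(nobC _ odd_j)[y Hy] /(nobB _ odd_j)[z Hz].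
exists (row_mx y z); rewrite mul_row_block.
by rewrite !(mulmx0, addr0, add0r) -Hy -Hz.
Qed.

(** The condition [no_odd_block] for multiplication by N on F[t]/(p). *)
Definition no_odd_block_poly N p := forall q j, odd j -> p %| q * N ^+ j ->
  exists y, p %| q * N ^+ j.-1 - y * N ^+ j.

Lemma no_odd_block_cyclic k (C : 'M[F]_k) e p N : size p = k.+1 ->
  ann C e p -> no_odd_block_poly N p -> no_odd_block (mxeval C N).
Proof.
move=> size_p He nobp j odd_j x.
have Ku : krylov k C e \in unitmx by rewrite -row_free_unit (krylov_free size_p He).
rewrite -(mulmxKV Ku x) mul_krylov; set q := rVpoly _.
rewrite -!rmorphXn /= -!mulmxA -!mxevalM => /eqP; rewrite He => /(nobp q j odd_j)[y].
rewrite -He rmorphB /= mulmxBr subr_eq0 => /eqP->.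
by exists (e *m mxeval C y); rewrite -mulmxA -mxevalM.
Qed.

Lemma no_odd_block_poly_coprime N p : coprimep N p -> no_odd_block_poly N p.
Proof.
move=> cop q j odd_j _.
have /Bezout_eq1_coprimepP[[u w] /= uw] : coprimep (N ^+ j) p by apply: coprimep_expl.
exists (q * N ^+ j.-1 * u); rewrite -mulrA -{1}[q * _]mulr1 -mulrBr -uw.
by rewrite addrAC subrr add0r mulrA dvdp_mull.
Qed.

(** Modulo f^a the factor g is invertible, so multiplication by f g is
    nilpotent with one block, of size a, per basis element of F[t]/(f).  If
    a <= j then a <= j-1 by parity and y = 0 works; if j < a then
    f^(a-j) divides q, and y is q/f times an inverse of g modulo f^a. *)
Lemma no_odd_block_even_power f g a : coprimep f g -> f != 0 -> ~~ odd a ->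
  no_odd_block_poly (f * g) (f ^+ a).
Proof.
move=> cop_fg f0 even_a q j odd_j.
have cop a' b : coprimep (f ^+ a') (g ^+ b).
  by rewrite coprimep_expl // coprimep_expr.
rewrite exprMn mulrA Gauss_dvdpl //.
have [le_aj _|lt_ja] := leqP a j.
  exists 0; rewrite mul0r subr0 exprMn mulrCA dvdp_mulr // dvdp_exp2l //.
  have: a != j by apply: contraNneq even_a => ->.
  by case: j odd_j le_aj => // j _; rewrite leq_eqVlt => /orP[->|].
have Da := subnK (ltnW lt_ja).
rewrite -{1}Da exprD dvdp_mul2r ?expf_neq0 // => /dvdpP[s ->].
have /Bezout_eq1_coprimepP[[u w] /= uw] := coprimep_expl a cop_fg.
exists (s * f ^+ (a - j).-1 * w).
case: j odd_j lt_ja Da => // j _ lt_ja Da; rewrite /=.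
have: (0 < a - j.+1)%N by rewrite subn_gt0.
case Dc: (a - j.+1)%N => [//|c] _ /=.
have uP : u * f ^+ a = 1 - w * g by rewrite -uw addrK.
rewrite -exprMn.
have -> : s * f ^+ c.+1 * (f * g) ^+ j - s * f ^+ c * w * (f * g) ^+ j.+1
   = s * f ^+ c.+1 * (f * g) ^+ j * (u * f ^+ a).
  by rewrite uP !exprS; ring.
by rewrite mulrA dvdp_mull.
Qed.

(** The class of 1 generates a chain of length exactly a, so q = 1 and j = a
    violate the condition. *)
Lemma odd_power_not_no_odd_block f g a : coprimep f g -> (1 < size f)%N -> odd a ->
  ~ no_odd_block_poly (f * g) (f ^+ a).
Proof.
move=> cop_fg f1 odd_a /(_ 1 a odd_a); rewrite mul1r exprMn dvdp_mulr //.
have f0 : f != 0 by rewrite -size_poly_gt0 ltnW.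
case=> // y; rewrite dvdp_subl; last by rewrite mulrCA dvdp_mulr.
case: a odd_a => // a _; rewrite mul1r exprMn exprSr dvdp_mul2l ?expf_neq0 //.
have cop : coprimep f (g ^+ a) by rewrite coprimep_expr.
move=> fg; move: cop; rewrite /coprimep; have /eqp_size -> : gcdp f (g ^+ a) %= f.
  exact: dvdp_gcd_idl.
by rewrite gtn_eqF.
Qed.

End NoOddBlock.

(** * Involutions anticommuting with a matrix *)

Section AntiCommutingInvolution.

Variable F : fieldType.
Hypothesis two_neq0 : 2%:R != 0 :> F.

(** Twice the projection onto the (-1)^b-eigenspace of the involution h. *)
Definition eigenproj n (h : 'M[F]_n) (b : bool) : 'M[F]_n :=
  1%:M + (-1) ^+ b *: h.
Local Notation P := eigenproj.

Section Involution.

Variables (n : nat) (h : 'M[F]_n).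
Hypothesis hh : h *m h = 1%:M.

Lemma eigenproj_mul b : P h b *m h = (-1) ^+ b *: P h b.
Proof.
rewrite /eigenproj mulmxDl mul1mx -scalemxAl hh scalerDr scalerA -expr2 sqrr_sign scale1r addrC.
by rewrite scalemx1.
Qed.

Lemma eigenproj_id k (x : 'M_(k, n)) (b : bool) : x *m h = (-1) ^+ b *: x ->
  x = 2%:R^-1 *: (x *m P h b).
Proof.
move=> xh; rewrite /eigenproj mulmxDr mulmx1 -scalemxAr xh scalerA -expr2 sqrr_sign scale1r.
by rewrite -mulr2n -scaler_nat scalerA mulVf // scale1r.
Qed.

Lemma rank_eigenproj_add : n = (\rank (P h false) + \rank (P h true))%N /\
  \det h = (-1) ^+ \rank (P h true).
Proof.
set K := row_base (P h false); set L := row_base (P h true).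
have KPh (b : bool) : row_base (P h b) *m h = (-1) ^+ b *: row_base (P h b).
  have /submxP[D ->] : (row_base (P h b) <= P h b)%MS by rewrite eq_row_base.
  by rewrite -mulmxA eigenproj_mul scalemxAr.
have freeKL : row_free (col_mx K L).
  rewrite /row_free -addsmxE mxrank_disjoint_sum ?eq_row_base //.
  apply/eqP; rewrite -submx0; apply/rV_subP => x; rewrite sub_capmx => /andP[].
  case/submxP=> u xK /submxP[w xL].
  have xh : x *m h = x by rewrite xK -mulmxA KPh expr0 scale1r.
  have xNh : x *m h = - x by rewrite xL -mulmxA KPh expr1 scaleN1r mulmxN.
  have /eqP : x *+ 2 = 0 by rewrite mulr2n -{1}xh xNh addNr.
  by rewrite -scaler_nat scaler_eq0 (negPf two_neq0) /= submx0.
have dim : n = (\rank (P h false) + \rank (P h true))%N.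
  apply/eqP; rewrite eqn_leq -{2}(eqP freeKL) rank_leq_col andbT.
  apply: leq_trans (mxrank_add _ _).
  suff -> : P h false + P h true = 2%:R%:M by rewrite -scalemx1 mxrank_scale_nz ?mxrank1.
  by rewrite /eigenproj expr0 scale1r expr1 scaleN1r addrACA subrr addr0 -raddfD.
split=> //; have := det_invariant_split dim freeKL (C := 1%:M) (B := (-1)%:M).
rewrite det1 det_scalar mul1r; apply.
  by rewrite KPh expr0 scale1r mul1mx.
by rewrite KPh expr1 mul_scalar_mx.
Qed.

Variable M : 'M[F]_n.
Hypothesis hM : h *m M = - (M *m h).

Lemma eigenproj_swap b : P h b *m M = M *m P h (~~ b).
Proof.
rewrite /eigenproj mulmxDl mulmxDr mul1mx mulmx1 -scalemxAl hM -scalemxAr; congr (_ + _).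
by rewrite scalerN -scaleNr; case: b; rewrite ?opprK.
Qed.

Lemma eigenproj_swap_expr b k : P h b *m M ^+ k = M ^+ k *m P h (b (+) odd k).
Proof.
elim: k b => [|k IHk] b; first by rewrite !expr0 mulmx1 mul1mx addbF.
by rewrite exprS mulmxA eigenproj_swap -mulmxA IHk mulmxA addNb -addbN.
Qed.

Lemma eigenproj_mul_expr b k :
  P h b *m M ^+ k *m h = (-1) ^+ (b (+) odd k) *: (P h b *m M ^+ k).
Proof. by rewrite eigenproj_swap_expr -mulmxA eigenproj_mul scalemxAr. Qed.

Let a b k := \rank (P h b *m M ^+ k).

(** With V_b the (-1)^b-eigenspace of h, a b k is dim V_b M^k.  As M exchanges
    signs, V_b M^(k+1) lies in V_(~~ b) M^k. *)
Lemma eigenrank_mono b k : (a b k.+1 <= a (~~ b) k)%N.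
Proof. by rewrite /a exprS mulmxA eigenproj_swap -mulmxA mxrankM_maxr. Qed.

Hypothesis nobM : no_odd_block M.

(** By rank-nullity for M, it suffices that V_b M^(k-1) and V_(~~ b) M^k, which
    have the same sign for k odd, meet ker M in the same space.  The second
    lies in the first; conversely a vector x of V_b M^(k-1) in ker M is some
    y M^k since M has no block of size k, and projecting x to its own
    eigenspace projects y to V_(~~ b). *)
Lemma eigenrank_step b k : odd k -> (a b k.-1 + a (~~ b) k.+1 = a b k + a (~~ b) k)%N.
Proof.
case: k => // k odd_k; rewrite /= in odd_k.
have rk c j : (a c j.+1 + \rank (P h c *m M ^+ j :&: kermx M)%MS = a c j)%N.
  by rewrite /a -(mxrank_mul_ker (P h c *m M ^+ j) M) -mulmxA exprSr.
rewrite -[a b k.+1.-1]rk -[in RHS](rk (~~ b)) addnAC -addnA; congr (_ + (_ + _))%N.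
apply/eqmx_rank/andP; split; last first.
  rewrite capmxS // exprS mulmxA eigenproj_swap negbK -mulmxA.
  exact: submxMl.
rewrite sub_capmx capmxSr andbT; apply/rV_subP => x; rewrite sub_capmx.
case/andP=> /submxP[u Dx] /sub_kermxP xM.
have [|y Hy] := @nobM k.+1 odd_k (u *m P h b).
  by rewrite exprSr mulmxA -(mulmxA u) -Dx.
have xy : x = y *m M ^+ k.+1 by rewrite Dx mulmxA Hy.
have xh : x *m h = (-1) ^+ b *: x.
  rewrite Dx -!mulmxA (mulmxA _ _ h) eigenproj_mul_expr -scalemxAr.
  by rewrite (negPf odd_k) addbF.
rewrite (eigenproj_id xh) xy scalemx_sub // -mulmxA.
have := eigenproj_swap_expr (~~ b) k.+1; rewrite /= odd_k addbT negbK => <-.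
exact: submxMl.
Qed.

(** The two instances of [eigenrank_step] at odd k have the same right-hand
    side, so the difference of the two ranks is the same at k-1 and k+1. *)
Lemma eigenrank_even b k : (a b k.*2 + a (~~ b) 0 = a (~~ b) k.*2 + a b 0)%N.
Proof.
elim: k => [|k IHk]; first by rewrite addnC.
have odd_k : odd k.*2.+1 by rewrite /= odd_double.
have := eigenrank_step b odd_k; have := eigenrank_step (~~ b) odd_k.
rewrite negbK doubleS /=; lia.
Qed.

(** Infinite descent: if dim V_b > dim V_(~~ b), then [eigenrank_even] gives
    dim V_b M^(2k) > dim V_(~~ b) M^(2k) for all k, and the latter is at least
    dim V_b M^(2k+1), hence at least dim V_b M^(2k+2). *)
Lemma eigenrank_le b : (a b 0 <= a (~~ b) 0)%N.
Proof.
rewrite leqNgt; apply/negP => lt_ab.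
suff /(_ (a b 0).+1) : forall k, (a b k.*2 + k <= a b 0)%N by lia.
elim=> [|k IHk]; first by rewrite addn0.
have := eigenrank_even b k; have := eigenrank_mono b k.*2.
have : (a b k.*2.+2 <= a b k.*2.+1)%N by rewrite /a exprSr mulmxA mxrankM_maxl.
rewrite doubleS; lia.
Qed.

Lemma det_anticommuting_involution : ~~ odd n /\ \det h = (-1) ^+ n./2.
Proof.
have [Dn det_h] := rank_eigenproj_add.
have eq_rk : \rank (P h false) = \rank (P h true).
  have := eigenrank_le false; have := eigenrank_le true.
  by rewrite /a !expr0 !mulmx1 /= => le1 le2; apply/eqP; rewrite eqn_leq le1 le2.
rewrite eq_rk addnn in Dn; rewrite det_h.
by move: (\rank _) Dn => r ->; rewrite odd_double doubleK.
Qed.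

End Involution.

End AntiCommutingInvolution.

(** * The determinant when no block has odd size *)

Section ReversalDeterminant.

Variable F : fieldType.

Lemma no_odd_block_unit n (U M : 'M[F]_n) : U \in unitmx -> U *m M = M *m U ->
  no_odd_block (U *m M) -> no_odd_block M.
Proof.
move=> Uu comm nob k odd_k x xM.
have UMk j : (U *m M) ^+ j = M ^+ j *m U ^+ j.
  by rewrite comm [LHS]exprMn_comm.
have [|y] := nob k odd_k x; first by rewrite UMk mulmxA xM mul0mx.
case: k odd_k xM => // k _ _; rewrite !UMk /= => Hy; exists (y *m U).
have Uk : U ^+ k *m (invmx U) ^+ k = 1%:M by rewrite inverse_expr ?subnn ?mulmxV.
rewrite -[LHS]mulmx1 -Uk mulmxA -(mulmxA x) Hy (exprS U) !mulmxA.
by rewrite -(mulmxA _ (U ^+ k)) Uk mulmx1 -!mulmxA (intertwine_expr _ comm).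
Qed.

(** A reversing involution anticommutes with A - A^-1, which differs from
    A^2 - 1 by the commuting unit A and so has the same nilpotent blocks. *)
Lemma reversal_det n (A h : 'M[F]_n) : 2%:R != 0 :> F -> A \in unitmx ->
    reverses A h -> no_odd_block (mxeval A ('X^2 - 1)) ->
  ~~ odd n /\ \det h = (-1) ^+ n./2.
Proof.
move=> two_neq0 Au rev_h nob; have hA := reverses_inv Au rev_h.
have [hh AhA] := rev_h.
have hD : h *m invmx A = A *m h by rewrite -{1}AhA mulmxK.
apply: (det_anticommuting_involution two_neq0 hh (M := A - invmx A)).
  by rewrite mulmxBr mulmxBl hA hD opprB.
apply: (no_odd_block_unit Au).
  by rewrite mulmxBr mulmxBl mulmxV // mulVmx.
suff <- : mxeval A ('X^2 - 1) = A *m (A - invmx A) by [].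
by rewrite rmorphB rmorph1 /= mxevalXn mulmxBr mulmxV // expr2.
Qed.

End ReversalDeterminant.

(** * The polynomial t^2 - 1 *)

Section PolynomialX2Sub1.

Variable F : fieldType.
Implicit Types (p q : {poly F}).

Lemma X2sub1_factor (e : F) : e ^+ 2 = 1 ->
  'X^2 - 1 = ('X - e%:P) * ('X + e%:P) :> {poly F}.
Proof. by move=> ee; rewrite -subr_sqr -rmorphXn /= ee. Qed.

Lemma coprimep_X2sub1_factors (e : F) : 2%:R != 0 :> F -> e ^+ 2 = 1 ->
  coprimep ('X - e%:P) ('X + e%:P).
Proof.
move=> two_neq0 ee; have -> : 'X + e%:P = 'X - (- e)%:P by rewrite polyCN opprK.
apply: coprimep_XsubC2; rewrite -opprD oppr_eq0 -mulr2n -mulr_natl mulf_neq0 //.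
by apply: contraNneq (oner_neq0 F) => e0; rewrite -ee e0 expr0n.
Qed.

Lemma coprimep_X2sub1 p : ~~ root p 1 -> ~~ root p (-1) -> coprimep ('X^2 - 1) p.
Proof.
move=> p1 pN1; rewrite (X2sub1_factor (expr1n _ 2)) coprimep_sym coprimepMr coprimep_XsubC p1.
by rewrite -[1%:P]opprK -polyCN coprimep_XsubC.
Qed.

End PolynomialX2Sub1.

(** * Existence of reversing involutions *)

Section RankReal.

Variable F : fieldType.

(** A shadow of the similarity of A and A^-1 that is additive over direct sums,
    and hence can be cancelled: see [rank_real_diag]. *)
Definition rank_real n (A : 'M[F]_n) :=
  forall p, \rank (mxeval A p) = \rank (mxeval (invmx A) p).

Lemma rank_uconj n (T A B : 'M[F]_n) : T \in unitmx -> T *m A = B *m T ->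
  \rank A = \rank B.
Proof.
move=> Tu TA; have freeT : row_free T by rewrite row_free_unit.
rewrite -(mxrankMfree B freeT) -TA -[RHS]mxrank_tr trmx_mul mxrankMfree ?mxrank_tr //.
by rewrite row_free_unit unitmx_tr.
Qed.

Lemma reverses_rank_real n (A h : 'M[F]_n) :
  A \in unitmx -> reverses A h -> rank_real A.
Proof.
move=> Au rev_h p; have hA := reverses_inv Au rev_h; have [hh _] := rev_h.
have [hu _] := mulmx1_unit hh.
exact: rank_uconj hu (mxeval_intertwine _ hA).
Qed.

Lemma rank_real_uconj n (A B T : 'M[F]_n) : T \in unitmx -> A \in unitmx ->
  B \in unitmx -> T *m A = B *m T -> rank_real A -> rank_real B.
Proof.
move=> Tu Au Bu TA realA p; rewrite -(rank_uconj Tu (mxeval_intertwine p TA)) realA.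
apply: rank_uconj Tu (mxeval_intertwine p _).
by rewrite -[LHS](mulKmx Bu) (mulmxA B) -TA mulmxK.
Qed.

Lemma rank_real_diag k l (C : 'M[F]_k) (B : 'M[F]_l) :
    block_mx C 0 0 B \in unitmx -> rank_real C ->
  rank_real (block_mx C 0 0 B) -> rank_real B.
Proof.
move=> u realC realCB p; have := realCB p.
by rewrite invmx_block_diag // !mxeval_block !rank_diag_block_mx realC => /addnI.
Qed.

(** For e = 1 or -1, A^-1 - e = - e (A - e) A^-1. *)
Lemma mxeval_inv_XsubC_exp n (A : 'M[F]_n) (v : 'rV_n) e a : A \in unitmx -> e ^+ 2 = 1 ->
    v *m mxeval A (('X - e%:P) ^+ a) = 0 ->
  v *m mxeval (invmx A) (('X - e%:P) ^+ a) = 0.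
Proof.
move=> Au ee; set p := 'X - e%:P.
have Dp : mxeval (invmx A) p = (- e) *: (mxeval A p *m invmx A).
  rewrite !rmorphB /= !mxevalX !mxevalC mulmxBl mulmxV // scalerBr mul_scalar_mx.
  by rewrite scalerA mulNr -expr2 ee scaleN1r opprK scalemx1 rmorphN /= addrC.
have comm q : invmx A *m mxeval A q = mxeval A q *m invmx A.
  by apply: mxeval_intertwine; rewrite mulVmx ?mulmxV.
have Dpa : mxeval (invmx A) (p ^+ a) = (- e) ^+ a *: (mxeval A (p ^+ a) *m invmx A ^+ a).
  elim: a => [|a IHa]; first by rewrite !expr0 !rmorph1 scale1r mulmx1.
  rewrite [in LHS]exprS mxevalM IHa Dp -scalemxAl -scalemxAr scalerA -exprS.
  rewrite (exprS p) mxevalM (exprS (invmx A)); congr (_ *: _).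
  by rewrite !mulmxA -(mulmxA _ (invmx A)) comm !mulmxA.
by move=> vp; rewrite Dpa -scalemxAr mulmxA vp mul0mx scaler0.
Qed.

End RankReal.

Section ReversalDichotomy.

Variable F : finFieldType.
Implicit Types (p q r : {poly F}).

(** A primary piece at an eigenvalue 1 or -1 has a single block, whose size is
    the dimension of the piece; without such eigenvalues A^2 - 1 is invertible
    and the whole minimal polynomial may be taken. *)
Lemma cyclic_piece n (A : 'M[F]_n.+1) : A \in unitmx -> rank_real A ->
  exists p r v, [/\ mxeval A (p * r) = 0, coprimep p r, ann A v p, (1 < size p)%N &
    v *m mxeval (invmx A) p = 0 /\
    (2%:R != 0 :> F -> ~~ odd (size p).-1 -> no_odd_block_poly ('X^2 - 1) p)].
Proof.
move=> Au realA; have [v Hv] := cyclic_vector A; set m := mxminpoly A in Hv.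
have m0 : m != 0 by rewrite monic_neq0 ?mxminpoly_monic.
have mA : mxeval A m = 0 by rewrite mxevalE mx_root_minpoly.
have [[e ee root_e]|no_root] : (exists2 e, e ^+ 2 = 1 & root m e) \/
    (~~ root m 1 /\ ~~ root m (-1)).
- have [m1|m1] := boolP (root m 1); first by left; exists 1; rewrite ?expr1n.
  have [mN1|mN1] := boolP (root m (-1)); last by right.
  by left; exists (-1); rewrite // sqrrN expr1n.
- have [a [q]] := multiplicity_XsubC m e; rewrite m0 /= => qe Dm.
  have q0 : q != 0 by apply: contraNneq qe => ->; rewrite root0.
  have a0 : (0 < a)%N.
    by rewrite lt0n; apply: contraNneq qe => a0; rewrite Dm a0 mulr1 in root_e.
  have Hq : ann A (v *m mxeval A q) (('X - e%:P) ^+ a).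
    by apply: ann_mul => //; rewrite mulrC -Dm.
  exists (('X - e%:P) ^+ a), q, (v *m mxeval A q); split=> //.
  + by rewrite mulrC -Dm.
  + by rewrite coprimep_expl // coprimep_sym coprimep_XsubC.
  + by rewrite size_exp_XsubC ltnS.
  split; first by apply: mxeval_inv_XsubC_exp => //; apply/eqP; rewrite Hq.
  rewrite size_exp_XsubC /= => two_neq0 even_a; rewrite (X2sub1_factor ee).
  apply: no_odd_block_even_power; rewrite ?polyXsubC_eq0 //.
  exact: coprimep_X2sub1_factors.
exists m, 1, v; split; rewrite ?mulr1 ?coprimep1 //.
  by rewrite size_mxminpoly ltnS mxminpoly_nonconstant.
split=> [|_ _]; last by case: no_root => m1 mN1; apply/no_odd_block_poly_coprime/coprimep_X2sub1.
suff -> : mxeval (invmx A) m = 0 by rewrite mulmx0.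
by apply/eqP; rewrite -mxrank_eq0 -realA mA mxrank0.
Qed.

(** In characteristic 2 the sign of the determinant is irrelevant, and only the
    existence of the involution is claimed. *)
Definition reversal_dichotomy n (A : 'M[F]_n) := (exists h, reverses A h) /\
  (2%:R != 0 :> F -> flexible A \/ no_odd_block (mxeval A ('X^2 - 1))).

Lemma reversal_dichotomy_split n k l (A : 'M[F]_n) (C : 'M_k) (B : 'M_l)
    (K : 'M_(k, n)) (M : 'M_(l, n)) e p :
    A \in unitmx -> rank_real A ->
    n = (k + l)%N -> row_free (col_mx K M) -> K *m A = C *m K -> M *m A = B *m M ->
    size p = k.+1 -> ann C e p -> e *m K *m mxeval (invmx A) p = 0 ->
    (2%:R != 0 :> F -> ~~ odd k -> no_odd_block_poly ('X^2 - 1) p) ->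
    (B \in unitmx -> rank_real B -> reversal_dichotomy B) ->
  reversal_dichotomy A.
Proof.
move=> Au realA dim_n; subst n; rewrite row_free_unit => Tu KA MA.
move=> size_p He eD nob_p IHB; set T := col_mx K M in Tu.
have TA : T *m A = block_mx C 0 0 B *m T.
  by rewrite mul_col_mx mul_block_col !mul0mx addr0 add0r KA MA.
have CBu : block_mx C 0 0 B \in unitmx.
  have: T *m A *m invmx T \in unitmx by rewrite !unitmx_mul Tu Au unitmx_inv.
  by rewrite TA mulmxK.
have := CBu; rewrite block_diag_mx_unit => /andP[Cu Bu].
have freeK : row_free K.
  apply: inj_row_free => u uK.
  have : row_mx u (0 : 'rV_l) = 0.
    by apply: (can_inj (mulmxK Tu)); rewrite mul_row_col uK !mul0mx addr0.
  by rewrite -row_mx0 => /eq_row_mx[].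
have [hC rev_hC] : exists h, reverses C h.
  apply: (cyclic_reversible size_p He (mulmxV Cu)).
  apply: (row_free_inj freeK); rewrite mul0mx -eD -mulmxA -mulmxA; congr (_ *m _).
  rewrite (mxeval_intertwine (C := invmx C)) //.
  by rewrite -[LHS](mulKmx Cu) (mulmxA C) -KA mulmxK.
have realB : rank_real B.
  apply: (rank_real_diag CBu (reverses_rank_real Cu rev_hC)).
  exact: (rank_real_uconj Tu Au CBu TA realA).
have [[hB rev_hB] dichB] := IHB Bu realB.
split=> [|two_neq0].
  by exists (invmx T *m block_mx hC 0 0 hB *m T); apply: reverses_uconj TA (reverses_diag _ _).
have [odd_k|even_k] := boolP (odd k).
  by left; apply: flexible_uconj TA (flexible_diagl (flexible_odd odd_k rev_hC) rev_hB).
have [flexB|nobB] := dichB two_neq0.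
  by left; apply: flexible_uconj TA (flexible_diagr rev_hC flexB).
right; apply: no_odd_block_uconj Tu (mxeval_intertwine _ TA) _.
rewrite mxeval_block; apply: no_odd_block_diag => //.
exact: no_odd_block_cyclic size_p He (nob_p two_neq0 even_k).
Qed.

Theorem reversal_dichotomyP n (A : 'M[F]_n) : A \in unitmx -> rank_real A ->
  reversal_dichotomy A.
Proof.
have [N le_N] := ubnP n; elim: N n le_N A => // N IHN [_ | n lt_n] A Au realA.
  split=> [|_]; first by exists 1%:M; split; rewrite thinmx0 // [RHS]thinmx0.
  by right=> k _ x _; exists 0; rewrite thinmx0 [RHS]thinmx0.
have [p [r [v [pr0 cop_pr Hv p1 [vpD nob_p]]]]] := cyclic_piece Au realA.
have [k size_p] : exists k, size p = k.+1 by exists (size p).-1; rewrite prednK // ltnW.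
have [l [C [B [K [M [dim_n free_T KA MA [e [He eK]]]]]]]] := cyclic_split size_p cop_pr pr0 Hv.
rewrite size_p ltnS in p1 nob_p.
apply: (reversal_dichotomy_split Au realA dim_n free_T KA MA size_p He _ nob_p).
  by rewrite eK.
by apply: IHN; lia.
Qed.

End ReversalDichotomy.

(** * Reading the blocks off the elementary divisors *)

Section ElementaryDivisorBlocks.

Variable F : fieldType.
Implicit Types (p q f : {poly F}) (s : seq ({poly F} * nat)).

Lemma in_qpoly_eq e p q : e \is monic -> (1 < size e)%N ->
  (in_qpoly e p == in_qpoly e q) = (e %| p - q).
Proof.
move=> mon_e e1; have me : mk_monic e = e by rewrite /mk_monic mon_e e1.
rewrite -val_eqE /= me -!Pdiv.IdomainMonic.modpE //.
by rewrite -subr_eq0 -modpN -modpD.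
Qed.

Section ModuleIso.

Variables (n : nat) (g : 'M[F]_n.+1) (s : seq ({poly F} * nat)).
Variable phi : cyclic_sum s -> 'cV[F]_n.+1.
Hypothesis eldiv_ok : forall fa, fa \in s ->
  [/\ fa.1 \is monic, irreducible_poly fa.1, fa.1 != 'X & (0 < fa.2)%N].
Hypothesis phi_iso : module_iso g phi.

Definition cyclic_class (P : 'I_(size s) -> {poly F}) : cyclic_sum s :=
  [ffun j => in_qpoly (eldiv j) (P j)].

Lemma eldiv_monic_size (j : 'I_(size s)) : eldiv j \is monic /\ (1 < size (eldiv j))%N.
Proof.
rewrite /eldiv; have := mem_tnth j (in_tuple s); case: (tnth _ j) => f a /= /eldiv_ok.
case=> /= mon_f [f1 _] _ a_gt0; split; first by rewrite monic_exp.
by rewrite -subn_gt0 subn1 size_exp muln_gt0 a_gt0 -subn1 subn_gt0 f1.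
Qed.

Lemma cyclic_class_mul p P :
  phi (cyclic_class (fun j => p * P j)) = horner_mx g p *m phi (cyclic_class P).
Proof.
have [_ <- _] := phi_iso; congr phi; apply/ffunP => j; rewrite !ffunE.
by rewrite rmorphM.
Qed.

Lemma cyclic_class_surj y : exists P, phi (cyclic_class P) = y.
Proof.
have [_ _ [psi _ psiK]] := phi_iso.
exists (fun j => psi y j : {poly F}); rewrite -[RHS]psiK; congr phi.
apply/ffunP => j; rewrite !ffunE; apply/val_inj.
exact: in_qpoly_small (size_mk_monic _).
Qed.

Lemma cyclic_class_eq P Q :
  phi (cyclic_class P) = phi (cyclic_class Q) <-> forall j, eldiv j %| P j - Q j.
Proof.
have [_ _ [psi phiK _]] := phi_iso.
split=> [/(can_inj phiK)/ffunP eqPQ j|eqPQ].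
  have [mon_j size_j] := eldiv_monic_size j.
  by rewrite -in_qpoly_eq //; have:= eqPQ j; rewrite !ffunE => ->.
congr phi; apply/ffunP => j; rewrite !ffunE; apply/eqP.
by have [mon_j size_j] := eldiv_monic_size j; rewrite in_qpoly_eq.
Qed.

Lemma cyclic_class0 P : phi (cyclic_class P) = 0 <-> forall j, eldiv j %| P j.
Proof.
have -> : 0 = phi (cyclic_class (fun=> 0 * 0)).
  by rewrite (cyclic_class_mul 0 (fun=> 0)) rmorph0 mul0mx.
by rewrite cyclic_class_eq; split=> dvd j; have:= dvd j; rewrite mul0r subr0.
Qed.

(** Through phi, the rows x with x N(g^T)^k = 0 become families of polynomials
    P j with eldiv j dividing N^k P j, so the condition splits over j. *)
Lemma no_odd_block_eldiv N :
  no_odd_block (mxeval g^T N) <-> forall j : 'I_(size s), no_odd_block_poly N (eldiv j).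
Proof.
have mulN i (x : 'rV_n.+1) : x *m mxeval g^T N ^+ i = (horner_mx g (N ^+ i) *m x^T)^T.
  by rewrite trmx_mul trmxK -mxevalE -mxeval_tr rmorphXn.
split=> [nob j q i odd_i dvd_q | nob i odd_i x].
  pose P k := if k == j then q else 0.
  have [|y] := nob i odd_i (phi (cyclic_class P))^T.
    rewrite mulN trmxK -cyclic_class_mul; apply/eqP; rewrite trmx_eq0; apply/eqP.
    by apply/cyclic_class0 => k; rewrite /P; case: eqP => [->|_]; rewrite mulrC ?mul0r.
  have [Y HY] := cyclic_class_surj y^T; rewrite !mulN trmxK -HY -!cyclic_class_mul.
  move/trmx_inj/cyclic_class_eq/(_ j); rewrite /P eqxx => dvd_j.
  by exists (Y j); rewrite mulrC (mulrC (Y j)).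
have [P HP] := cyclic_class_surj x^T.
rewrite !mulN -HP -!cyclic_class_mul => /eqP; rewrite trmx_eq0 => /eqP/cyclic_class0 dvdP.
have /fin_all_exists[Y HY] j : exists y, eldiv j %| N ^+ i.-1 * P j - N ^+ i * y.
  have [|y Hy] := nob j (P j) i odd_i; first by rewrite mulrC.
  by exists y; rewrite mulrC (mulrC _ y).
exists (phi (cyclic_class Y))^T; rewrite mulN trmxK -cyclic_class_mul.
by congr _^T; apply/cyclic_class_eq.
Qed.

End ModuleIso.

Lemma monic_irredp_root f (e : F) : f \is monic -> irreducible_poly f -> root f e ->
  f = 'X - e%:P.
Proof.
move=> mon_f irr_f; rewrite -dvdp_XsubCl => dvd_f; apply/esym/eqP.
rewrite -eqp_monic ?monicXsubC //; apply: irr_f => //.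
by rewrite size_XsubC.
Qed.

Lemma no_odd_block_irredp_power f a : 2%:R != 0 :> F ->
    f \is monic -> irreducible_poly f ->
  no_odd_block_poly ('X^2 - 1) (f ^+ a) <-> ~~ (odd a && (root f 1 || root f (-1))).
Proof.
move=> two_neq0 mon_f irr_f.
have root_case e : e ^+ 2 = 1 -> root f e ->
    no_odd_block_poly ('X^2 - 1) (f ^+ a) <-> ~~ odd a.
  move=> ee /monic_irredp_root Df; rewrite (X2sub1_factor ee) Df //.
  have cop := coprimep_X2sub1_factors two_neq0 ee.
  split=> [nob|even_a]; last by apply: no_odd_block_even_power; rewrite ?polyXsubC_eq0.
  by apply/negP => odd_a; apply: odd_power_not_no_odd_block nob; rewrite ?size_XsubC.
have [r1|r1] := boolP (root f 1); first by rewrite andbT; apply: root_case r1; rewrite expr1n.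
have [rN1|rN1] := boolP (root f (-1)).
  by rewrite andbT; apply: root_case rN1; rewrite sqrrN expr1n.
rewrite andbF; split=> // _.
by apply: no_odd_block_poly_coprime; rewrite coprimep_expr // coprimep_X2sub1.
Qed.

(** No f in s vanishes at 0, as f would then be t; so the factor that
    normalizes the constant term is nonzero. *)
Lemma root_type_poly s i (e : F) :
    (forall fa, fa \in s -> [/\ fa.1 \is monic, irreducible_poly fa.1,
       fa.1 != 'X & (0 < fa.2)%N]) ->
  root (type_poly s i) e <-> exists2 fa, fa \in s & fa.2 = i /\ root fa.1 e.
Proof.
move=> s_ok; rewrite /type_poly; set p := \prod_(_ <- _ | _) _.
have rootp x : root p x <-> exists2 fa, fa \in s & fa.2 = i /\ root fa.1 x.
  rewrite /root /p horner_prod prodf_seq_eq0.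
  split=> [/hasP[fa s_fa /andP[/eqP Di r]]|[fa s_fa [Di r]]]; first by exists fa.
  by apply/hasP; exists fa => //; rewrite Di eqxx.
have p0 : p`_0 != 0.
  rewrite -horner_coef0; apply/negP => /rootp[fa s_fa [_ r0]].
  have [mon_f irr_f /eqP[]] := s_ok fa s_fa.
  by rewrite (monic_irredp_root mon_f irr_f r0) subr0.
by rewrite rootZ ?invr_eq0.
Qed.

Definition has_odd_block s :=
  has (fun fa => odd fa.2 && (root fa.1 1 || root fa.1 (-1))) s.

Lemma has_odd_block_type_poly n (g : 'M[F]_n.+1) s : elementary_divisors g s ->
  has_odd_block s <->
  exists i, odd i /\ (root (type_poly s i) 1 \/ root (type_poly s i) (-1)).
Proof.
case=> s_ok _; split=> [/hasP[fa s_fa /andP[odd_a root_f]]|[i [odd_i root_i]]].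
  exists fa.2; split=> //.
  by case/orP: root_f; [left | right]; apply/(root_type_poly _ _ s_ok); exists fa.
by apply/hasP; case: root_i => /(root_type_poly _ _ s_ok)[fa s_fa [Di root_f]];
  exists fa; rewrite // Di odd_i root_f ?orbT.
Qed.

Lemma no_odd_block_elementary_divisors n (g : 'M[F]_n.+1) s : 2%:R != 0 :> F ->
  elementary_divisors g s ->
  no_odd_block (mxeval g^T ('X^2 - 1)) <-> ~~ has_odd_block s.
Proof.
move=> two_neq0 [s_ok [phi phi_iso]].
rewrite (no_odd_block_eldiv s_ok phi_iso); split=> [nob|/hasPn even_s j].
  apply/hasPn => fa s_fa; have [mon_f irr_f _ _] := s_ok fa s_fa.
  have /tnthP[j Dj] : fa \in in_tuple s by [].
  have := nob j; rewrite /eldiv -Dj; case: fa {Dj s_fa} mon_f irr_f => f a /=.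
  by move=> mon_f irr_f /(no_odd_block_irredp_power _ two_neq0 mon_f irr_f).
rewrite /eldiv; have := mem_tnth j (in_tuple s).
case: (tnth _ j) => f a s_fa; have [/= mon_f irr_f _ _] := s_ok _ s_fa.
by apply/(no_odd_block_irredp_power _ two_neq0 mon_f irr_f); apply: even_s s_fa.
Qed.

End ElementaryDivisorBlocks.

(** * Strong reality in the special linear group *)

Section GeneralLinearGroup.

Variables (F : finFieldType) (n : nat).
Implicit Types g : {'GL_n[F]}.

Lemma two_neq0_odd_card : odd #|F| = (2%:R != 0 :> F).
Proof.
have [p p_pr charFp] := finPcharP F.
have cardF := card_pprimeChar charFp; set k := (X in (p ^ X)%N) in cardF.
have k_gt0 : (0 < k)%N.
  by rewrite lt0n; apply: contraTneq (finNzRing_gt1 F) => k0; rewrite cardF k0.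
rewrite cardF oddX gtn_eqF //= -(dvdn_pcharf charFp) dvdn_prime2 //.
by apply/idP/idP; [apply: contraTneq => -> | apply: contraNT => /(prime_oddPn p_pr)->].
Qed.

Lemma strongly_real_inSL_reverses g :
  strongly_real_in (SL n F) g <-> exists h, reverses (GLval g)^T h /\ \det h = 1.
Proof.
split=> [[h [h_SL hh hg]]|[h [[hh AhA] det_h]]].
  exists (GLval h)^T; rewrite det_tr; split; last by move: h_SL; rewrite inE => /eqP.
  have hhM : GLval h *m GLval h = 1%:M.
    by have /(congr1 val) := hh; rewrite expgS expg1.
  split; first by rewrite -trmx_mul hhM trmx1.
  rewrite -!trmx_mul; congr _^T.
  have hgh : (g * h * g = h)%g.
    have hV : (h^-1 = h)%g by apply/eqP; rewrite eq_invg_mul -expg2 hh.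
    by have := hg; rewrite hV => /(canRL (mulgK h)) gh; rewrite -mulgA gh hV mulKVg.
  by have /(congr1 val) := hgh; rewrite /= mulmxA.
have hu : h^T \in unitmx by rewrite unitmx_tr; case: (mulmx1_unit hh).
pose H : {'GL_n[F]} := FinRing.unit _ hu.
have HH : (H * H = 1)%g.
  by apply: val_inj; rewrite -[RHS]trmx1 -hh trmx_mul.
exists H; split.
- by rewrite inE /= det_tr det_h.
- by rewrite expgS expg1.
have HV : (H^-1 = H)%g by apply/eqP; rewrite eq_invg_mul HH.
have gHg : (g * H * g = H)%g.
  by apply: val_inj; rewrite /= -[RHS]trmxK trmxK -{2}AhA !trmx_mul trmxK mulmxA.
have Hg : (H * g = g^-1 * H)%g by rewrite -{2}gHg !mulgA mulVg mul1g.
by rewrite HV Hg -mulgA HH mulg1.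
Qed.

Lemma real_rank_real g : real_in 'GL_n[F]%G g -> rank_real (GLval g)^T.
Proof.
case=> h _ hg p; have gh : (g * h^-1 = h^-1 * g^-1)%g by rewrite -hg !mulgA mulVg mul1g.
have Tu : (GLval h^-1)^T \in unitmx by rewrite unitmx_tr GL_unitmx.
apply: rank_uconj Tu (mxeval_intertwine p _).
rewrite -trmx_inv -!trmx_mul; congr _^T.
exact: (congr1 val gh).
Qed.

Lemma strongly_real_real (gT : finGroupType) (G : {group gT}) (x : gT) :
  strongly_real_in G x -> real_in G x.
Proof. by case=> h [Gh _ hx]; exists h. Qed.

End GeneralLinearGroup.

Theorem theorem6p1 (F : finFieldType) (n : nat) (n_gt0 : (0 < n)%N)
    (g : {'GL_n[F]}) (gSL : g \in SL n F) (g_real : real_in 'GL_n[F]%G g) :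
  ((n %% 4 != 2)%N \/ ~~ odd #|F| ->
     real_in (SL n F) g /\ strongly_real_in (SL n F) g)
  /\
  ((n %% 4 == 2)%N -> odd #|F| ->
     forall s : seq ({poly F} * nat), elementary_divisors (GLval g) s ->
     (strongly_real_in (SL n F) g <->
      exists i : nat,
        odd i /\ (root (type_poly s i) 1 \/ root (type_poly s i) (-1)))).
Proof.
have Au : (GLval g)^T \in unitmx by rewrite unitmx_tr GL_unitmx.
have [[h rev_h] dich] := reversal_dichotomyP Au (real_rank_real g_real).
have flex : flexible (GLval g)^T -> strongly_real_in (SL n F) g.
  by move=> /(_ false) /strongly_real_inSL_reverses.
have prednK' := prednK n_gt0.
split.
  move=> cases; suff sr : strongly_real_in (SL n F) g by split=> //; apply: strongly_real_real.
  have [two_neq0|/negPn/eqP two0] := boolP (2%:R != 0 :> F); last first.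
    apply/strongly_real_inSL_reverses; exists h; split=> //.
    have [[] ->] := involution_det rev_h.1; rewrite ?expr0 // expr1.
    by apply/eqP; rewrite eq_sym -subr_eq0 opprK -two0.
  have [/flex //|nob] := dich two_neq0.
  have [even_n det_h] := reversal_det two_neq0 Au rev_h nob.
  apply/strongly_real_inSL_reverses; exists h; split=> //; rewrite det_h.
  rewrite -signr_odd; suff -> : odd (n.-1.+1)./2 = false by [].
  have : (n.-1.+1 %% 4 != 2)%N by case: cases; rewrite ?prednK' // two_neq0_odd_card two_neq0.
  by move: even_n; lia.
move=> n2; rewrite two_neq0_odd_card => two_neq0 s s_eldiv.
rewrite -(has_odd_block_type_poly s_eldiv); split=> [|odd_s].
  case/strongly_real_inSL_reverses=> k [rev_k det_k]; apply/negPn/negP => even_s.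
  have nob := (no_odd_block_elementary_divisors two_neq0 s_eldiv).2 even_s.
  have [even_n] := reversal_det two_neq0 Au rev_k nob.
  rewrite det_k -signr_odd; have -> : odd (n.-1.+1)./2 = true by move: n2; rewrite prednK'; lia.
  by move/eqP; rewrite expr1 -subr_eq0 opprK (negPf two_neq0).
have [/flex //|nob] := dich two_neq0.
by have := (no_odd_block_elementary_divisors two_neq0 s_eldiv).1 nob; rewrite odd_s.
Qed.
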